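(* Let $m>1$ be an integer, let $(G_n)_{n\ge 2}$ be a sequence of random graphs following the inverse de-preferential attachment model with parameter $m$, and let $i\ge1$ be fixed. Then there exist constants $0<c<C$ such that, as $n\to\infty$, $$P\left(c\le\frac{d_i(n)}{m\sqrt{\log n}}\le C\right)\longrightarrow1.$$
   Context: Inverse de-preferential attachment model with parameter $m>1$: $G_n$ is a multigraph with vertices $v_1,\dots,v_n$, and $d_i(n)$ is the degree of $v_i$ in $G_n$ (all incident edges and half-edges counted, with multiplicity). The process starts from $G_2$, consisting of two vertices $v_1,v_2$ joined by $m$ edges together with $m$ extra ''free'' edges (half-edges) attached to one of the two vertices, which count toward that vertex's degree; thus the degrees in $G_2$ are $m$ and $2m$. Given $G_n$ ($n\ge2$), a new vertex $v_{n+1}$ with $m$ half-edges $e_{n+1,1},\dots,e_{n+1,m}$ is added, and these are attached one after the other to vertices among $v_1,\dots,v_n$. Let $d_j(n+1,k)$, $k=0,\dots,m-1$, be the degree of $v_j$, $1\le j\le n$, after $k$ of the half-edges of $v_{n+1}$ have been attached, with $d_j(n+1,0)=d_j(n)$, and let $\mathscr{F}_{n+1,k}$ be the natural filtration of the process at that stage. Then for $j=1,\dots,n$ and $k=0,\dots,m-1$, $$P(e_{n+1,k+1}=\{v_j,v_{n+1}\}\mid\mathscr{F}_{n+1,k})=\frac{C_{n+1,k}}{d_j(n+1,k)},\qquad C_{n+1,k}^{-1}=\sum_{j=1}^n\frac{1}{d_j(n+1,k)}.$$ Each attachment raises the degree of the chosen vertex by one; $d_j(n+1)$, $j\le n$,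 is the degree of $v_j$ after all $m$ half-edges have been attached, and $d_{n+1}(n+1)=m$. *)

(* Defs.v *)
From HB Require Import structures.
From mathcomp Require Import all_boot all_order all_algebra.
From mathcomp Require Import all_classical all_reals all_analysis.
Import Order.TTheory GRing.Theory Num.Theory.
Import numFieldNormedType.Exports.

Set Implicit Arguments.
Unset Strict Implicit.
Unset Printing Implicit Defensive.

Local Open Scope classical_set_scope.
Local Open Scope ring_scope.

(* Multigraph on the vertices v_1, ..., v_(nverts), each named by its index;
   edges and half-edges are listed with multiplicity. *)
Record multigraph := Multigraph {
  nverts : nat;
  edges : seq (nat * nat);
  half_edges : seq nat
}.

Definition degree (g : multigraph) (v : nat) : nat :=
  (\sum_(e <- edges g) ((e.1 == v) + (e.2 == v)) + count_mem v (half_edges g))%N.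

(* v is the endpoint of the m free half-edges of G_2. *)
Definition initial_graph (m v : nat) : multigraph :=
  Multigraph 2 (nseq m (1%N, 2%N)) (nseq m v).

Definition add_vertex (m : nat) (g : multigraph) : multigraph :=
  Multigraph (nverts g).+1 (edges g)
             (nseq m (nverts g).+1 ++ half_edges g).

(* Turns one half-edge of the most recent vertex into an edge to v_j. *)
Definition attach (g : multigraph) (j : nat) : multigraph :=
  Multigraph (nverts g) ((j, nverts g) :: edges g)
             (rem (nverts g) (half_edges g)).

Section ConditionalProbability.
Context {d : measure_display} {T : measurableType d} {R : realType}.

(* X is a version of the conditional probability P(A | F), for a
   sub-sigma-algebra F of the events. *)
Definition is_cond_prob (P : probability T R) (F : set (set T)) (A : set T)
    (X : T -> R) : Prop :=
  (forall B : set R, measurable B -> F (X @^-1` B)) /\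
  (forall B : set T, F B -> P (A `&` B) = (\int[P]_(w in B) (X w)%:E)%E).

End ConditionalProbability.

Section Model.
Context {T : Type}.
Variables (m : nat) (G : nat -> T -> multigraph) (target : nat -> nat -> T -> nat).

(* [target n k w = j] means e_(n,k) = {v_j, v_n}.  [stage n k] is the graph
   obtained from G_(n-1) by adding v_n and attaching its first k half-edges;
   the other m - k remain half-edges at v_n. *)
Definition stage (n k : nat) (w : T) : multigraph :=
  foldl attach (add_vertex m (G n.-1 w)) [seq target n l w | l <- iota 1 k].

(* Sigma-algebra generated by the graphs at all stages up to (n, k), in
   lexicographic order; G_2 is recovered from [stage 3 0]. *)
Definition natural_filtration (n k : nat) : set (set T) :=
  <<s [set A | exists n' k' g,
         [/\ (2 < n')%N, (k' <= m)%N,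
             (n' < n)%N || ((n' == n) && (k' <= k)%N) &
             A = stage n' k' @^-1` [set g]]] >>.

Definition norm_const (R : realType) (n k : nat) (w : T) : R :=
  (\sum_(1 <= j < n) ((degree (stage n k w) j)%:R)^-1)^-1.

End Model.

Record inverse_de_preferential_attachment (R : realType) (d : measure_display)
    (T : measurableType d) (P : probability T R) (m : nat)
    (G : nat -> T -> multigraph) (target : nat -> nat -> T -> nat) : Prop := {
  initial_state : forall w : T,
    G 2%N w = initial_graph m 1 \/ G 2%N w = initial_graph m 2;
  initial_measurable : forall g : multigraph, measurable (G 2%N @^-1` [set g]);
  target_range : forall (n k : nat) (w : T), (2 <= n)%N -> (k < m)%N ->
    (1 <= target n.+1 k.+1 w <= n)%N;
  target_measurable : forall n k j : nat, (2 <= n)%N -> (k < m)%N ->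
    measurable (target n.+1 k.+1 @^-1` [set j]);
  next_state : forall (n : nat) (w : T), (2 <= n)%N ->
    G n.+1 w = stage m G target n.+1 m w;
  attachment_rule : forall n k j : nat,
    (2 <= n)%N -> (k < m)%N -> (1 <= j <= n)%N ->
    is_cond_prob P (natural_filtration m G target n.+1 k)
      (target n.+1 k.+1 @^-1` [set j])
      (fun w => norm_const m G target R n.+1 k w
                  / (degree (stage m G target n.+1 k w) j)%:R)
}.

(* Main.v *)
Require Import Defs.
From HB Require Import structures.
From mathcomp Require Import all_boot all_order all_algebra.
From mathcomp Require Import all_classical all_reals all_analysis.
From mathcomp Require Import measurable_realfun.
From mathcomp Require Import zify ring lra.
Import Order.TTheory GRing.Theory Num.Theory.
Import numFieldNormedType.Exports.

(** The degrees at stage (n+1,k) are positive and sum to at most 2mn over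
    v_1, ..., v_n, so the normalising constant lies in [1/n, 2m/n].  Hence
    the tail probabilities Q(v) = P(d_i >= v) satisfy, at each attachment,
      (Q(v) - Q(v+1)) / (n v) <= Q'(v+1) - Q(v+1)
                              <= 2m (Q(v) - Q(v+1)) / (n v).
    Above a level D every increment of d_i has probability at most 2m/(n D),
    below D at least 1/(n D).  Taking D of order sqrt(log n), exponential
    weights propagate through these recursions: e^v Q(v) grows at most by a
    factor exp(O(sqrt(log n))), and e^(-v) (1 - Q(v+1)) decays at least by
    exp(-m sqrt(log n)) when D = (1 - 1/e) sqrt(log n). *)

Set Implicit Arguments.
Unset Strict Implicit.
Unset Printing Implicit Defensive.

Local Open Scope classical_set_scope.
Local Open Scope ring_scope.

(** * Multigraphs as a countable type *)

Definition multigraph_code (g : multigraph) :=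
  (nverts g, edges g, half_edges g).

Definition multigraph_decode (c : nat * seq (nat * nat) * seq nat) :=
  Multigraph c.1.1 c.1.2 c.2.

Lemma multigraph_codeK : cancel multigraph_code multigraph_decode.
Proof. by case. Qed.

(** Countability reduces measurability of any event about the graphs to that of the fibres over
    single graphs. *)
HB.instance Definition _ := Countable.copy multigraph (can_type multigraph_codeK).

(** * Degrees under the graph operations *)

Lemma degree_add_vertex m g v :
  degree (add_vertex m g) v = (degree g v + m * (v == (nverts g).+1))%N.
Proof.
rewrite /degree /add_vertex /= count_cat count_nseq /= (eq_sym v).
by rewrite mulnC; lia.
Qed.

(** At the newest vertex the new edge replaces the half-edge removed by [rem], so only the end at
    [j] changes a degree. Membership guarantees that [rem] does delete one. *)
Lemma degree_attach g j v : nverts g \in half_edges g ->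
  degree (attach g j) v = (degree g v + (j == v))%N.
Proof.
move=> gin; rewrite /degree /attach /= big_cons /= count_rem gin /=.
have : (nverts g == v <= count_mem v (half_edges g))%N.
  by case: eqP => // <-; rewrite -has_count has_pred1.
by move: (nat_of_bool (nverts _ == _)) (nat_of_bool (j == _))
  (\sum_(_ <- _) _)%N (count _ _) => a b c e; lia.
Qed.

Lemma nverts_foldl_attach g s : nverts (foldl attach g s) = nverts g.
Proof. by elim: s g => //= j s IH g; rewrite IH. Qed.

Lemma degree_foldl_attach g s v :
  (size s <= count_mem (nverts g) (half_edges g))%N ->
  degree (foldl attach g s) v = (degree g v + count_mem v s)%N.
Proof.
elim: s g => [|j s IH] g /= hs; first by rewrite addn0.
have gin : nverts g \in half_edges g.
  by rewrite -has_pred1 has_count; apply: leq_trans hs.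
rewrite IH; first by rewrite degree_attach // addnA.
by rewrite count_rem gin /= eqxx; lia.
Qed.

Lemma sum_count_mem (s : seq nat) n :
  (\sum_(1 <= j < n.+1) count_mem j s <= size s)%N.
Proof.
elim: s => [|x s IH] /=; first by rewrite big1.
rewrite big_split /=.
suff h : (\sum_(1 <= j < n.+1) (x == j) <= 1)%N by
  rewrite -add1n; exact: leq_add h IH.
have [xn|xn] := boolP (x \in index_iota 1 n.+1).
  rewrite (bigD1_seq x) ?iota_uniq //= eqxx big1 // => j.
  by rewrite eq_sym => /negbTE ->.
rewrite big_seq big1 // => j jn.
by case: eqP => // xj; rewrite xj jn in xn.
Qed.

Lemma degree_initial_graph m n v :
  degree (initial_graph m n) v = (m * (v == 1) + m * (v == 2) + m * (v == n))%N.
Proof.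
rewrite /degree /= big_nseq iter_addn_0 count_nseq /=.
by rewrite !(eq_sym v); lia.
Qed.

Lemma iota_rcons n k : iota n k.+1 = rcons (iota n k) (n + k).
Proof. by rewrite -cats1 -[[:: _]]/(iota (n + k) 1) -iotaD addn1. Qed.

(** * Degrees along the process and the total degree *)

Section Degrees.
Context {R : realType} {d : measure_display} {T : measurableType d}.
Context {P : probability T R} {m : nat}.
Context {G : nat -> T -> multigraph} {target : nat -> nat -> T -> nat}.
Hypothesis hG : inverse_de_preferential_attachment P m G target.

Local Notation stg := (stage m G target).

Lemma stageS n k w :
  stg n k.+1 w = attach (stg n k w) (target n k.+1 w).
Proof. by rewrite /stage iota_rcons map_rcons foldl_rcons. Qed.

Lemma nverts_G n w : (2 <= n)%N -> nverts (G n w) = n.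
Proof.
elim: n => // n IH; rewrite leq_eqVlt => /predU1P[<-|n2].
  by case: (initial_state hG w) => ->.
by rewrite (next_state hG) // /stage nverts_foldl_attach /= IH.
Qed.

Lemma degree_stage n k w v : (2 <= n)%N -> (k <= m)%N ->
  degree (stg n.+1 k w) v = (degree (G n w) v + m * (v == n.+1) +
    count_mem v [seq target n.+1 l w | l <- iota 1 k])%N.
Proof.
move=> n2 km; rewrite /stage degree_foldl_attach /=.
  by rewrite degree_add_vertex nverts_G.
by rewrite size_map size_iota count_cat count_nseq /= eqxx; lia.
Qed.

Lemma degree_stage0 n w v : (2 <= n)%N -> (v <= n)%N ->
  degree (stg n.+1 0 w) v = degree (G n w) v.
Proof.
move=> n2 vn; rewrite degree_stage //=.
by rewrite (_ : v == n.+1 = false) ?muln0 ?addn0 //; lia.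
Qed.

Lemma degree_stageS n k w v : (2 <= n)%N -> (k < m)%N ->
  degree (stg n.+1 k.+1 w) v =
  (degree (stg n.+1 k w) v + (target n.+1 k.+1 w == v))%N.
Proof.
move=> n2 km; rewrite !degree_stage //; last exact: ltnW.
by rewrite iota_rcons map_rcons -cats1 count_cat /= addn0 addnA.
Qed.

Lemma count_target_gt n k w v : (2 <= n)%N -> (k <= m)%N -> (n < v)%N ->
  count_mem v [seq target n.+1 l w | l <- iota 1 k] = 0%N.
Proof.
move=> n2 km nv; apply/count_memPn/mapP => -[[|l]]; rewrite mem_iota // => lk vE.
have := @target_range _ _ _ _ _ _ _ hG n l w n2; rewrite -vE.
by lia.
Qed.

Lemma degree_G_gt n w v : (2 <= n)%N -> (n < v)%N -> degree (G n w) v = 0%N.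
Proof.
elim: n => // n IH; rewrite leq_eqVlt => /predU1P[<-|n2] nv.
  by case: (initial_state hG w) => ->; rewrite degree_initial_graph; lia.
rewrite (next_state hG) // degree_stage // IH //; last lia.
rewrite (_ : v == n.+1 = false) ?muln0; last lia.
by rewrite count_target_gt //; lia.
Qed.

Lemma degree_G_gt0 n w v : (0 < m)%N -> (2 <= n)%N -> (0 < v <= n)%N ->
  (0 < degree (G n w) v)%N.
Proof.
move=> m0; elim: n => // n IH; rewrite leq_eqVlt => /predU1P[<-|n2] vn.
  by case: (initial_state hG w) => ->; rewrite degree_initial_graph; lia.
rewrite (next_state hG) // degree_stage //.
have [->|vn1] := eqVneq v n.+1; first by lia.
by rewrite addn_gt0 addn_gt0 IH //; lia.
Qed.

Lemma sum_degree_stage n k w : (2 <= n)%N -> (k <= m)%N ->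
  (\sum_(1 <= j < n.+1) degree (stg n.+1 k w) j <=
   \sum_(1 <= j < n.+1) degree (G n w) j + k)%N.
Proof.
move=> n2 km.
have := sum_count_mem [seq target n.+1 l w | l <- iota 1 k] n.
rewrite size_map size_iota => /(leq_add (leqnn (\sum_(1 <= j < n.+1) degree (G n w) j))).
rewrite -big_split /=; apply: leq_trans.
rewrite big_nat [leqRHS]big_nat leq_sum // => j jn.
rewrite degree_stage //.
by rewrite (_ : j == n.+1 = false) ?muln0 ?addn0 //; lia.
Qed.

(** Every new vertex brings m edges, hence 2m to the total degree, which is 3m at n = 2. The spare m
    on the left absorbs what the old vertices gain while the next vertex is being attached. *)
Lemma sum_degree_G n w : (2 <= n)%N ->
  (\sum_(1 <= j < n.+1) degree (G n w) j + m <= 2 * m * n)%N.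
Proof.
elim: n => // n IH; rewrite leq_eqVlt => /predU1P[<-|n2].
  rewrite unlock /=.
  by case: (initial_state hG w) => ->; rewrite !degree_initial_graph; lia.
rewrite big_nat_recr //= (next_state hG) //.
have := sum_degree_stage w n2 (leqnn m); have := IH n2.
have -> : degree (stg n.+1 m w) n.+1 = m.
  by rewrite degree_stage // degree_G_gt // eqxx count_target_gt //; lia.
by lia.
Qed.

Lemma sum_degree_stage_le n k w : (2 <= n)%N -> (k <= m)%N ->
  (\sum_(1 <= j < n.+1) degree (stg n.+1 k w) j <= 2 * m * n)%N.
Proof.
move=> n2 km; apply: leq_trans (sum_degree_stage w n2 km) _.
by apply: leq_trans (sum_degree_G w n2); rewrite leq_add2l.
Qed.

End Degrees.

(** * Measurability of the stages *)

Lemma sigma_algebra_preimage_countType (T : Type) (C : countType)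
    (F : set (set T)) (f : T -> C) : sigma_algebra setT F ->
  (forall c, F (f @^-1` [set c])) -> forall B, F (f @^-1` B).
Proof.
move=> [F0 _ FU] Ff B.
(* [A k] is the fibre over the element of [B] coded by [k], empty if there is none, so the preimage
   of [B] is a countable union. *)
pose A k := if unpickle k is Some c then
  if asbool (B c) then f @^-1` [set c] else set0 else set0.
rewrite (_ : _ @^-1` _ = \bigcup_k A k).
  by apply: FU => k; rewrite /A; case: unpickle => // c; case: ifP.
apply/seteqP; split=> [w Bfw|w [k _]]; last first.
  by rewrite /A /=; case: unpickle => // c; case: ifPn => // /asboolP Bc /= ->.
by exists (pickle (f w)) => //; rewrite /A pickleK; case: asboolP.
Qed.

Section Measurability.
Context {R : realType} {d : measure_display} {T : measurableType d}.
Context {P : probability T R} {m : nat}.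
Context {G : nat -> T -> multigraph} {target : nat -> nat -> T -> nat}.
Hypothesis hG : inverse_de_preferential_attachment P m G target.

Local Notation stg := (stage m G target).

Lemma measurable_preimage_countType (C : countType) (f : T -> C) :
  (forall c, measurable (f @^-1` [set c])) -> forall B, measurable (f @^-1` B).
Proof.
by apply: sigma_algebra_preimage_countType; exact: sigma_algebra_measurable.
Qed.

Lemma measurable_stage n k g : (2 <= n)%N -> (k <= m)%N ->
  (forall g', measurable (G n @^-1` [set g'])) ->
  measurable (stg n.+1 k @^-1` [set g]).
Proof.
move=> n2 + mG; elim: k g => [|k IH] g km.
  rewrite (_ : _ @^-1` _ = G n @^-1` [set g' | add_vertex m g' = g]) //.
  exact: measurable_preimage_countType.
(* The next stage is a function of the pair (current stage, target), which lives in a countable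
   type; fibres of single pairs suffice. *)
rewrite (_ : _ @^-1` _ = (fun w => (stg n.+1 k w, target n.+1 k.+1 w)) @^-1`
    [set x | attach x.1 x.2 = g]); last first.
  by apply/seteqP; split=> w /=; rewrite stageS.
apply: measurable_preimage_countType => -[g' j].
rewrite (_ : _ @^-1` _ =
  stg n.+1 k @^-1` [set g'] `&` target n.+1 k.+1 @^-1` [set j]).
  apply: measurableI; first by apply: IH; exact: ltnW.
  exact: (target_measurable hG).
by apply/seteqP; split=> w /= [-> ->].
Qed.

Lemma measurable_G n g : (2 <= n)%N -> measurable (G n @^-1` [set g]).
Proof.
elim: n g => // n IH g; rewrite leq_eqVlt => /predU1P[<-|n2].
  exact: (initial_measurable hG).
rewrite (_ : _ @^-1` _ = stg n.+1 m @^-1` [set g]).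
  by apply: measurable_stage => // g'; exact: IH.
by apply/seteqP; split=> w /=; rewrite (next_state hG).
Qed.

Lemma natural_filtration_stage n k B : (2 <= n)%N -> (k <= m)%N ->
  natural_filtration m G target n.+1 k (stg n.+1 k @^-1` B).
Proof.
move=> n2 km; apply: sigma_algebra_preimage_countType.
  exact: smallest_sigma_algebra.
move=> g; apply: sub_sigma_algebra.
by exists n.+1, k, g; split=> //; rewrite eqxx leqnn orbT.
Qed.

Lemma natural_filtration_measurable n k A :
  natural_filtration m G target n k A -> measurable A.
Proof.
apply: smallest_sub; first exact: sigma_algebra_measurable.
move=> _ [n' [k' [g [n'2 k'm _ ->]]]].
case: n' n'2 => // n' n'2.
by apply: measurable_stage => // g'; exact: measurable_G.
Qed.

End Measurability.

(** * Bounds on the normalising constant *)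

Section Attachment.
Context {R : realType} {d : measure_display} {T : measurableType d}.
Context {P : probability T R} {m : nat}.
Context {G : nat -> T -> multigraph} {target : nat -> nat -> T -> nat}.
Hypotheses (hG : inverse_de_preferential_attachment P m G target) (m0 : (0 < m)%N).

Local Notation stg := (stage m G target).

Lemma degree_stage_gt0 n k w j : (2 <= n)%N -> (k <= m)%N -> (0 < j <= n)%N ->
  (0 < degree (stg n.+1 k w) j)%N.
Proof.
move=> n2 km jn; rewrite (degree_stage hG) // -addnA ltn_addr //.
exact: (degree_G_gt0 hG).
Qed.

Lemma sum_inv_degree_le n k w : (2 <= n)%N -> (k <= m)%N ->
  \sum_(1 <= j < n.+1) ((degree (stg n.+1 k w) j)%:R)^-1 <= n%:R :> R.
Proof.
move=> n2 km; rewrite big_nat.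
apply: (@le_trans _ _ (\sum_(1 <= j < n.+1 | (1 <= j < n.+1)%N) 1)).
  apply: ler_sum => j jn; rewrite invf_le1 ?ler1n ?ltr0n;
  exact: degree_stage_gt0.
by rewrite -big_nat big_const_nat iter_addr_0 subn1.
Qed.

(* 1/x lies above its tangent line at 2m, and the degrees average to at most
   2m. *)
Lemma sum_inv_degree_ge n k w : (2 <= n)%N -> (k <= m)%N ->
  n%:R / (2 * m%:R) <=
  \sum_(1 <= j < n.+1) ((degree (stg n.+1 k w) j)%:R)^-1 :> R.
Proof.
move=> n2 km; have mR : 0 < m%:R :> R by rewrite ltr0n.
apply: (@le_trans _ _ (\sum_(1 <= j < n.+1)
    (1 / m%:R - (degree (stg n.+1 k w) j)%:R / (4 * m%:R ^+ 2)))); last first.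
  rewrite big_nat [leRHS]big_nat; apply: ler_sum => j jn.
  have : 0 < (degree (stg n.+1 k w) j)%:R :> R.
    by rewrite ltr0n degree_stage_gt0.
  move: (_%:R) => x x0.
  rewrite -subr_ge0 (_ : _ - _ = (x - 2 * m%:R) ^+ 2 / (4 * m%:R ^+ 2 * x)).
    by rewrite divr_ge0 ?sqr_ge0 // !mulr_ge0 ?ltW // exprn_gt0.
  by field; rewrite !lt0r_neq0.
have := sum_degree_stage_le hG w n2 km.
rewrite -(ler_nat R) natr_sum; set x : R := \sum_(_ <= _ < _) _ => xle.
rewrite sumrB -!mulr_suml -/x big_const_nat iter_addr_0 subn1 /=.
rewrite -subr_ge0 -[_ *+ n]mulr_natr.
rewrite (_ : _ - _ = ((2 * m * n)%:R - x) / (4 * m%:R ^+ 2)).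
  by rewrite divr_ge0 ?subr_ge0 // mulr_ge0 // sqr_ge0.
by rewrite !natrM; field; rewrite lt0r_neq0.
Qed.

Lemma norm_const_bounds n k w : (2 <= n)%N -> (k <= m)%N ->
  n%:R^-1 <= norm_const m G target R n.+1 k w <= 2 * m%:R / n%:R.
Proof.
move=> n2 km; have mR : 0 < m%:R :> R by rewrite ltr0n.
have nR : 0 < n%:R :> R by rewrite ltr0n ltnW.
have slo := sum_inv_degree_ge w n2 km; have shi := sum_inv_degree_le w n2 km.
have s0 := lt_le_trans (divr_gt0 nR (mulr_gt0 (ltr0n R 2) mR)) slo.
rewrite /norm_const lef_pV2 ?posrE // shi /= -[leRHS]invf_div lef_pV2 ?posrE //.
by rewrite divr_gt0 // mulr_gt0.
Qed.

End Attachment.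

(** * From the attachment rule to recursions for the tails *)

Lemma is_cond_prob_bounds (R : realType) (d : measure_display)
    (T : measurableType d) (P : probability T R) (F : set (set T)) (A B : set T)
    (X : T -> R) (a b : R) :
  F `<=` measurable -> measurable A -> is_cond_prob P F A X -> F B -> 0 <= a ->
  (forall w, B w -> a <= X w <= b) ->
  a * fine (P B) <= fine (P (A `&` B)) <= b * fine (P B).
Proof.
move=> mF mA [mX PX] FB a0 Xab.
have mB := mF _ FB.
have mABfin : P (A `&` B) \is a fin_num by exact/fin_num_measure/measurableI.
have mBfin : P B \is a fin_num by exact: fin_num_measure.
have mXE : measurable_fun B (fun w => (X w)%:E).
  apply/measurable_EFinP => _ C mC; apply: measurableI => //.
  exact/mF/mX.
rewrite -!lee_fin !EFinM !fineK // PX // -!(integral_cst P mB).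
apply/andP; split; apply: ge0_le_integral => //= w Bw; rewrite lee_fin.
- by have /andP[] := Xab _ Bw.
- by have /andP[/(le_trans a0)] := Xab _ Bw.
- by have /andP[] := Xab _ Bw.
Qed.

Section Tail.
Context {R : realType} {d : measure_display} {T : measurableType d}.
Context {P : probability T R} {m : nat}.
Context {G : nat -> T -> multigraph} {target : nat -> nat -> T -> nat}.
Hypotheses (hG : inverse_de_preferential_attachment P m G target) (m0 : (0 < m)%N).

Local Notation stg := (stage m G target).

(** Here [n] counts the older vertices: the stage is that of v_(n+1), with [k] of its half-edges
    attached. *)
Definition degree_tail i n k v : R :=
  fine (P [set w | (v <= degree (stg n.+1 k w) i)%N]).

(** One attachment raises a degree by at most one, so the tail at v + 1 gains exactly the
    probability that the degree equals v and v_i is chosen. Given degree v, the choice has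
    conditional probability C/v with C in [1/n, 2m/n]. *)
Lemma degree_tail_step i n k v : (2 <= n)%N -> (k < m)%N -> (0 < i <= n)%N ->
  (0 < v)%N ->
  (degree_tail i n k v - degree_tail i n k v.+1) / (n%:R * v%:R) <=
  degree_tail i n k.+1 v.+1 - degree_tail i n k v.+1 <=
  2 * m%:R * (degree_tail i n k v - degree_tail i n k v.+1) / (n%:R * v%:R).
Proof.
move=> n2 km hi v0.
set a := degree_tail i n k.+1 v.+1 - degree_tail i n k v.+1.
set q := degree_tail i n k v - degree_tail i n k v.+1.
have mR : 0 < m%:R :> R by rewrite ltr0n.
have nR : 0 < n%:R :> R by rewrite ltr0n ltnW.
have vR : 0 < v%:R :> R by rewrite ltr0n.
pose A := target n.+1 k.+1 @^-1` [set i].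
pose B := [set w | degree (stg n.+1 k w) i = v].
have mdeg l (S : set nat) : (l <= m)%N ->
    measurable [set w | S (degree (stg n.+1 l w) i)].
  move=> lm; apply: (@natural_filtration_measurable _ _ _ _ _ _ _ hG n.+1 l).
  exact: (@natural_filtration_stage _ _ _ _ _ _ _ [set g | S (degree g i)]).
have mA : measurable A by exact: (target_measurable hG).
have FB : natural_filtration m G target n.+1 k B.
  exact: (@natural_filtration_stage _ _ _ _ _ _ _ [set g | degree g i = v] _ (ltnW km)).
have mB : measurable B by exact: (mdeg k [set v] (ltnW km)).
have mE l u : (l <= m)%N -> measurable [set w | (u <= degree (stg n.+1 l w) i)%N].
  by move=> lm; exact: (mdeg l [set u' | (u <= u')%N]).
have Pfin (C : set T) : measurable C -> P C \is a fin_num by exact: fin_num_measure.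
have qE : q = fine (P B).
  rewrite /q /degree_tail.
  rewrite (_ : [set w | (v <= _)%N] =
    [set w | (v.+1 <= degree (stg n.+1 k w) i)%N] `|` B); last first.
    apply/seteqP; split=> w /=; rewrite /B /=.
      by rewrite leq_eqVlt => /orP[/eqP<-|]; [right|left].
    by move=> [/ltnW//|->].
  rewrite measureU; [|exact: (mE k _ (ltnW km))|exact: mB|].
    rewrite fineD; [by rewrite addrAC subrr add0r| |exact: Pfin].
    exact: Pfin (mE k _ (ltnW km)).
  by apply/seteqP; split=> // w /= [vd dv]; rewrite dv ltnn in vd.
have aE : a = fine (P (A `&` B)).
  rewrite /a /degree_tail.
  rewrite (_ : [set w | (v.+1 <= degree (stg n.+1 k.+1 w) i)%N] =
    [set w | (v.+1 <= degree (stg n.+1 k w) i)%N] `|` (A `&` B)); last first.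
    apply/seteqP; split=> w /=; rewrite /A /B /= (degree_stageS hG) //.
      case: eqVneq => [->|_] /=; last by rewrite addn0; left.
      by rewrite addn1 ltnS leq_eqVlt => /orP[/eqP<-|]; [right|left].
    by move=> [vd|[-> ->]]; [exact: ltn_addr|rewrite eqxx addn1].
  have mAB : measurable (A `&` B) by exact: measurableI.
  rewrite measureU; [|exact: (mE k _ (ltnW km))|exact: mAB|].
    rewrite fineD; [by rewrite addrAC subrr add0r| |exact: Pfin].
    exact: Pfin (mE k _ (ltnW km)).
  by apply/seteqP; split=> // w /= [vd [_ dv]]; rewrite dv ltnn in vd.
have mF := @natural_filtration_measurable _ _ _ _ _ _ _ hG n.+1 k.
rewrite aE qE.
have [|w /= ->|lo hi'] := andP (is_cond_prob_bounds (a := (n%:R * v%:R)^-1)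
  (b := 2 * m%:R / (n%:R * v%:R)) mF mA (attachment_rule hG n2 km hi) FB _ _).
- by rewrite invr_ge0 mulr_ge0 // ltW.
- have /andP[clo chi] := norm_const_bounds hG m0 w n2 (ltnW km).
  by rewrite !invfM mulrA !ler_pM2r ?invr_gt0 // clo.
by rewrite mulrC lo /= mulrAC.
Qed.

End Tail.

(** Chronological order of the attachments: (n, 0), ..., (n, m), then (n+1, 0). The last premise is
    the arrival of a new vertex, which leaves the old degrees alone. *)
Lemma lexicographic_ind (S : nat -> nat -> Prop) (m n0 : nat) :
  S n0 0%N ->
  (forall n k, (n0 <= n)%N -> (k < m)%N -> S n k -> S n k.+1) ->
  (forall n, (n0 <= n)%N -> S n m -> S n.+1 0%N) ->
  forall n k, (n0 <= n)%N -> (k <= m)%N -> S n k.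
Proof.
move=> S0 SS Sm n k n0n; elim: k => [_|k IH km]; last first.
  by apply: SS => //; apply: IH; exact: ltnW.
elim: n n0n => [|n IH]; first by rewrite leqn0 => /eqP n0E; rewrite -[X in S X]n0E.
rewrite leq_eqVlt => /predU1P[<- //|n0n]; apply: Sm => //.
have Sn l : (l <= m)%N -> S n l.
  elim: l => [_|l IHl lm]; first exact: IH.
  by apply: SS => //; apply: IHl; exact: ltnW.
exact: Sn.
Qed.

(** * Harmonic sums, the clock of the process, against the logarithm *)

Definition harmonic_sum {R : realType} (n0 n : nat) : R :=
  \sum_(n0 <= l < n) l%:R^-1.

Section HarmonicSum.
Context {R : realType}.

Lemma harmonic_sumS n0 n : (n0 <= n)%N ->
  harmonic_sum n0 n.+1 = harmonic_sum n0 n + n%:R^-1 :> R.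
Proof. by move=> n0n; rewrite /harmonic_sum big_nat_recr. Qed.

Lemma harmonic_sum_ge0 n0 n : 0 <= harmonic_sum n0 n :> R.
Proof. by apply: sumr_ge0 => l _; rewrite invr_ge0. Qed.

(** Telescoping of ln(l+1) - ln l = ln(1 + 1/l) <= 1/l. *)
Lemma ln_le_harmonic_sum n0 n : (0 < n0)%N -> (n0 <= n)%N ->
  ln n%:R - ln n0%:R <= harmonic_sum n0 n :> R.
Proof.
move=> n00; elim: n => [|n IH]; first by rewrite leqn0 => /eqP n0E; rewrite n0E in n00.
rewrite leq_eqVlt => /predU1P[<-|n0n].
  by rewrite subrr harmonic_sum_ge0.
have nR : 0 < n%:R :> R by rewrite ltr0n (leq_trans n00).
rewrite harmonic_sumS //; have := IH n0n.
have -> : n.+1%:R = n%:R * (1 + n%:R^-1) :> R.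
  by rewrite mulrDr mulr1 divff ?gt_eqF // -natr1.
have n1 : 0 < n%:R^-1 :> R by rewrite invr_gt0.
rewrite lnM ?posrE ?addr_gt0 //.
have : ln (1 + n%:R^-1) <= n%:R^-1 :> R by apply: le_ln1Dx; lra.
lra.
Qed.

Lemma harmonic_sum_le_ln n0 n : (2 <= n0)%N -> (n0 <= n)%N ->
  harmonic_sum n0 n <= ln n%:R :> R.
Proof.
(* Strengthened to ln(n-1) for the induction, since ln(1 - 1/n) <= -1/n gives 1/n <= ln n - ln(n-1);
   [n0] at least 2 keeps the starting value ln(n0-1) nonnegative. *)
move=> n02 n0n; apply: (@le_trans _ _ (ln n.-1%:R)); last first.
  by rewrite ler_ln ?posrE ?ltr0n ?ler_nat; lia.
elim: n n0n => [|n IH]; first lia.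
rewrite leq_eqVlt => /predU1P[<-|n0n].
  by rewrite /harmonic_sum big_geq // ln_ge0 // ler1n; lia.
have nR : 0 < n%:R :> R by rewrite ltr0n; lia.
rewrite harmonic_sumS //= -lerBrDr; apply: le_trans (IH n0n) _.
have -> : n.-1%:R = n%:R * (1 - n%:R^-1) :> R.
  by rewrite mulrBr mulr1 divff ?gt_eqF // -subn1 natrB //; lia.
have n1 : n%:R^-1 < 1 :> R by rewrite invf_lt1 // ltr1n; lia.
rewrite lnM ?posrE ?subr_gt0 // lerD2l.
by apply: le_ln1Dx; rewrite ltrN2.
Qed.

End HarmonicSum.

(** * Exponential bounds for the upper and lower tails *)

Section TailBounds.
Context {R : realType} {d : measure_display} {T : measurableType d}.
Context {P : probability T R} {m : nat}.
Context {G : nat -> T -> multigraph} {target : nat -> nat -> T -> nat}.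
Hypotheses (hG : inverse_de_preferential_attachment P m G target) (m0 : (0 < m)%N).

Local Notation stg := (stage m G target).
Local Notation Q := (@degree_tail R d T P m G target).

Lemma measurable_degree_tail i n k v : (2 <= n)%N -> (k <= m)%N ->
  measurable [set w | (v <= degree (stg n.+1 k w) i)%N].
Proof.
move=> n2 km.
apply: (@natural_filtration_measurable _ _ _ _ _ _ _ hG n.+1 k).
exact: (@natural_filtration_stage _ _ _ _ _ _ _ [set g | (v <= degree g i)%N]).
Qed.

Lemma degree_tail_le1 i n k v : (2 <= n)%N -> (k <= m)%N -> Q i n k v <= 1.
Proof.
move=> n2 km; have mE := measurable_degree_tail i v n2 km.
rewrite -lee_fin fineK ?probability_le1 //.
exact: fin_num_measure.
Qed.

Lemma degree_tail_ge0 i n k v : 0 <= Q i n k v.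
Proof. by rewrite fine_ge0. Qed.

Lemma degree_tail1 i n k : (2 <= n)%N -> (k <= m)%N -> (0 < i <= n)%N ->
  Q i n k 1 = 1.
Proof.
move=> n2 km hi; rewrite /degree_tail (_ : mkset _ = setT) ?probability_setT //.
by apply/seteqP; split=> // w _ /=; exact: (degree_stage_gt0 hG).
Qed.

Lemma degree_tailS0 i n v : (2 <= n)%N -> (i <= n)%N -> Q i n.+1 0 v = Q i n m v.
Proof.
move=> n2 hi; congr (fine (P _)); apply/seteqP; split=> w /=;
by rewrite (degree_stage0 hG) ?(next_state hG) // leqW.
Qed.

(** One degree is at most the total degree, hence at most 2mn. This starts the induction for the
    upper tail. *)
Lemma degree_tail_initial i n v : (2 <= n)%N -> (0 < i <= n)%N ->
  (2 * m * n < v)%N -> Q i n 0 v = 0.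
Proof.
move=> n2 hi vn; rewrite /degree_tail (_ : mkset _ = set0) ?measure0 //.
apply/seteqP; split=> // w /=; apply/negP; rewrite -ltnNge.
apply: leq_ltn_trans vn; apply: leq_trans (sum_degree_stage_le hG w n2 (leq0n m)).
by rewrite (bigD1_seq i) ?iota_uniq ?mem_index_iota //= leq_addr.
Qed.

Lemma degree_tail_anti i n k v : (2 <= n)%N -> (k <= m)%N ->
  Q i n k v.+1 <= Q i n k v.
Proof.
move=> n2 km; rewrite /degree_tail fine_le //; try exact/fin_num_measure/measurable_degree_tail.
by apply: le_measure; rewrite ?inE; try exact: measurable_degree_tail; move=> w /= /ltnW.
Qed.

(** The clock m * [harmonic_sum n0 n] + k/n advances by 1/n per attachment. Up to level D + 1 the
    exponent is nonnegative and the bound trivial. Above it, a degree v > D increases with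
    probability at most eps = 2m/(nD), and the weight e^(-v) turns this into a factor 1 + e eps <=
    exp(e eps). *)
Lemma degree_tail_upper i n0 (D : R) : (2 <= n0)%N -> (0 < i <= n0)%N ->
  0 < D -> (2 * m * n0)%:R <= D ->
  forall n k, (n0 <= n)%N -> (k <= m)%N -> forall v,
  Q i n k v <= expR (D + 1 - v%:R +
    2 * m%:R * expR 1 / D * (m%:R * harmonic_sum n0 n + k%:R / n%:R)).
Proof.
move=> n02 hi D0 Dn0.
have c0 : 0 <= 2 * m%:R * expR 1 / D by rewrite !mulr_ge0 ?expR_ge0 // invr_ge0 ltW.
have e0 n k : 0 <= 2 * m%:R * expR 1 / D * (m%:R * harmonic_sum n0 n + k%:R / n%:R).
  apply: mulr_ge0 => //; apply: addr_ge0; last exact: divr_ge0.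
  by rewrite mulr_ge0 // harmonic_sum_ge0.
have small n k v : (2 <= n)%N -> (k <= m)%N -> v%:R <= D + 1 -> Q i n k v <= expR (D + 1 - v%:R +
    2 * m%:R * expR 1 / D * (m%:R * harmonic_sum n0 n + k%:R / n%:R)).
  move=> n2 km vD; apply: le_trans (degree_tail_le1 i v n2 km) _.
  by rewrite -[leLHS]expR0 ler_expR addr_ge0 // subr_ge0.
apply: lexicographic_ind => [v|n k n0n km IH [|v]|n n0n IH v].
- have [|vD] := leP v%:R (D + 1); first exact: small.
  (* At the start all degrees are at most 2 m n0 <= D, so this tail vanishes. *)
  rewrite degree_tail_initial ?expR_ge0 //.
  by rewrite -(ltr_nat R); lra.
- by apply: small => //; [lia|lra].
- have n2 : (2 <= n)%N by exact: leq_trans n0n.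
  have [|vD] := leP v.+1%:R (D + 1); first by apply: small => //; lia.
  (* Level v + 1 is reached from v, whose rate is controlled once v > D; hence the trivial range up
     to D + 1 rather than D. *)
  have {vD} Dv : D < v%:R by rewrite -natr1 in vD; lra.
  have v0 : (0 < v)%N by rewrite -(ltr_nat R); lra.
  have nR : 0 < n%:R :> R by rewrite ltr0n; lia.
  have hin : (0 < i <= n)%N by lia.
  have /andP[_] := degree_tail_step hG m0 n2 km hin v0.
  have := IH v; have := IH v.+1.
  rewrite -natr1 -[k.+1%:R]natr1.
  set x := 2 * _ * _ / D * (_ + k%:R / n%:R) => IHS IHv step.
  set eps := 2 * m%:R / (n%:R * D).
  have eps0 : 0 <= eps by rewrite divr_ge0 // mulr_ge0 // ltW.
  rewrite (_ : _ / D * _ = x + eps * expR 1); last first.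
    by rewrite /x /eps; field; rewrite !gt_eqF.
  apply: (@le_trans _ _ (Q i n k v.+1 + eps * Q i n k v)).
    rewrite -lerBlDl; apply: le_trans step _.
    rewrite /eps [leRHS]mulrAC; apply: ler_pM.
    + by rewrite !mulr_ge0 // subr_ge0 degree_tail_anti // ltnW.
    + by rewrite invr_ge0 mulr_ge0 // ltW.
    + by rewrite ler_wpM2l ?mulr_ge0 // gerBl degree_tail_ge0.
    + by rewrite lef_pV2 ?posrE ?mulr_gt0 ?(lt_trans D0 Dv) // ler_pM2l // ltW.
  apply: (@le_trans _ _ (expR (D + 1 - (v%:R + 1) + x) * (1 + eps * expR 1))).
    rewrite mulrDr mulr1 lerD // mulrCA ler_wpM2l // -expRD.
    by rewrite (_ : _ + x + 1 = D + 1 - v%:R + x) //; ring.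
  by rewrite addrA [leRHS]expRD ler_pM2l ?expR_gt0 // expR_ge1Dx.
- rewrite degree_tailS0; [|lia..].
  apply: le_trans (IH v) _; rewrite ler_expR lerD2l ler_wpM2l //.
  by rewrite harmonic_sumS // mul0r addr0 mulrDr lerD2l.
Qed.

(** The left side is P(d_i <= v), zero for v = 0 by positivity of degrees. With eps = 1/(nD), one
    attachment bounds it by (1 - eps) times its old value plus eps times the old value at v - 1. On
    the weight e^v this is a factor 1 - (1 - 1/e) eps, at most exp(-(1 - 1/e) eps). *)
Lemma degree_tail_lower i n0 (D : R) : (2 <= n0)%N -> (0 < i <= n0)%N -> 0 < D ->
  forall n k, (n0 <= n)%N -> (k <= m)%N -> forall v, v%:R <= D ->
  1 - Q i n k v.+1 <= expR (v%:R -
    (1 - expR (-1)) / D * (m%:R * harmonic_sum n0 n + k%:R / n%:R)).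
Proof.
move=> n02 hi D0.
apply: lexicographic_ind => [v vD|n k n0n km IH [|v] vD|n n0n IH v vD].
- rewrite /harmonic_sum big_geq // mulr0 mul0r addr0 mulr0 subr0.
  apply: (@le_trans _ _ 1); last by rewrite -[leLHS]expR0 ler_expR.
  by rewrite gerBl degree_tail_ge0.
- by rewrite degree_tail1 ?subrr ?expR_ge0 //; lia.
- have n2 : (2 <= n)%N by exact: leq_trans n0n.
  have nR : 1 < n%:R :> R by rewrite ltr1n; lia.
  have hin : (0 < i <= n)%N by lia.
  have /andP[step _] := degree_tail_step hG m0 n2 km hin (ltn0Sn v).
  have vD' : v%:R <= D by rewrite -natr1 in vD; lra.
  have := IH v vD'; have := IH v.+1 vD.
  rewrite -[k.+1%:R]natr1.
  set x := (1 - _) / D * (_ + k%:R / n%:R) => IHS IHv.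
  set eps := (n%:R * D)^-1.
  have eps0 : 0 <= eps by rewrite invr_ge0 mulr_ge0 // ltW.
  (* The coefficient 1 - eps must be nonnegative for the induction hypothesis to be inserted; D >= v
     + 1 >= 1 ensures it. *)
  have eps1 : eps <= 1.
    rewrite invf_le1 ?mulr_gt0 //; last lra.
    have : 1 <= D by rewrite -natr1 in vD; have := ler0n R v; lra.
    nra.
  rewrite (_ : _ / D * _ = x + (1 - expR (-1)) * eps); last first.
    by rewrite /x /eps; field; rewrite !gt_eqF //; lra.
  apply: (@le_trans _ _ ((1 - eps) * (1 - Q i n k v.+2) + eps * (1 - Q i n k v.+1))).
    (* The rate 1/(n(v+1)) of the recursion is at least eps because v + 1 <= D. *)
    have : eps * (Q i n k v.+1 - Q i n k v.+2) <= Q i n k.+1 v.+2 - Q i n k v.+2.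
      apply: le_trans step; rewrite mulrC ler_wpM2l ?subr_ge0 ?degree_tail_anti //; first lia.
      rewrite lef_pV2 ?posrE ?mulr_gt0 ?ler_pM2l //; lra.
    lra.
  apply: (@le_trans _ _ (expR (v.+1%:R - x) * (1 - (1 - expR (-1)) * eps))).
    rewrite [leRHS](_ : _ = (1 - eps) * expR (v.+1%:R - x) + eps * expR (v%:R - x)).
      by rewrite lerD // ler_wpM2l // subr_ge0.
    have -> : v%:R - x = v.+1%:R - x + -1 by rewrite -natr1; ring.
    by rewrite [expR (_ + -1)]expRD; ring.
  by rewrite opprD addrA [leRHS]expRD ler_pM2l ?expR_gt0 // expR_ge1Dx.
- rewrite degree_tailS0; [|lia..].
  apply: le_trans (IH v vD) _; rewrite ler_expR lerD2l lerN2 ler_wpM2l //.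
    by rewrite divr_ge0 ?ltW // subr_ge0 expR_le1 lerN10.
  by rewrite harmonic_sumS // mul0r addr0 mulrDr lerD2l.
Qed.

End TailBounds.

(** * Concentration of the degree and passage to the limit *)

Lemma cvgry_sqrt_ln (R : realType) :
  (Num.sqrt (ln n%:R) : R) @[n --> \oo] --> +oo.
Proof.
apply/cvgryPge => A; near=> n.
apply: le_trans (ler_norm A) _; rewrite -sqrtr_sqr ler_wsqrtr //.
rewrite -ler_expR lnK ?posrE.
  by near: n; exact: nbhs_infty_ger.
rewrite (lt_le_trans (expR_gt0 (A ^+ 2))) //.
by near: n; exact: nbhs_infty_ger.
Unshelve. all: by end_near. Qed.

Section Concentration.
Context {R : realType} {d : measure_display} {T : measurableType d}.
Context {P : probability T R} {m : nat}.
Context {G : nat -> T -> multigraph} {target : nat -> nat -> T -> nat}.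
Hypotheses (hG : inverse_de_preferential_attachment P m G target).

Local Notation Q := (@degree_tail R d T P m G target).

Lemma measurable_degree n i (S : set nat) : (2 <= n)%N ->
  measurable [set w | S (degree (G n w) i)].
Proof.
move=> n2; apply: (@measurable_preimage_countType _ _ _ (G n)
  _ [set g | S (degree g i)]) => g.
exact: (measurable_G hG).
Qed.

(** The event d_i >= v1 is covered by the window and the event d_i >= v2 + 1; stage (n+1, 0) still
    has the degrees of G_n at old vertices. *)
Lemma degree_window_prob i n (lo hi : R) (v1 v2 : nat) :
  (2 <= n)%N -> (i <= n)%N -> lo <= v1%:R -> v2%:R <= hi ->
  ((Q i n 0 v1 - Q i n 0 v2.+1)%:E <=
    P [set w | (lo <= (degree (G n w) i)%:R <= hi)%R])%E.
Proof.
move=> n2 hi' lo1 hi2.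
have mE v := @measurable_degree_tail _ _ _ _ _ _ _ hG i n 0 v n2 (leq0n m).
have fE v : P [set w | (v <= degree (stage m G target n.+1 0 w) i)%N] \is a fin_num.
  exact: fin_num_measure.
have mW : measurable [set w | lo <= (degree (G n w) i)%:R <= hi].
  exact: (measurable_degree i [set u | lo <= u%:R <= hi] n2).
rewrite EFinB !fineK // leeBlDr //.
apply: le_trans (measureU2 _ mW (mE _)).
apply: le_measure; rewrite ?inE //; first exact: measurableU.
move=> w /=; rewrite (degree_stage0 hG) // => v1d.
have [d2|] := leqP (degree (G n w) i) v2; [left|by right].
by rewrite (le_trans lo1) ?ler_nat //= (le_trans _ hi2) ?ler_nat.
Qed.

End Concentration.

Theorem theorem2p11 (R : realType) (d : measure_display)
    (T : measurableType d) (P : probability T R) (m : nat) (hm : (1 < m)%N)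
    (G : nat -> T -> multigraph) (target : nat -> nat -> T -> nat)
    (hG : inverse_de_preferential_attachment P m G target)
    (i : nat) (hi : (1 <= i)%N) :
  exists c C : R, [/\ 0 < c, c < C &
    P [set w | c <= (degree (G n w) i)%:R / (m%:R * Num.sqrt (ln n%:R)) <= C]
      @[n --> \oo] --> 1%E].
Proof.
have m0 : (0 < m)%N by exact: ltnW.
(* The lower tail has exponent about kappa s - m s with s = sqrt(log n); m >= 2 and kappa <= 1 bring
   it below -s up to a constant. *)
have mR : 2 <= m%:R :> R by rewrite ler_nat.
(* With D = kappa s, the decay rate (1 - 1/e)/D in the lower-tail bound is exactly 1/s. *)
pose kappa : R := 1 - expR (-1).
have kappa0 : 0 < kappa by rewrite subr_gt0 expR_lt1 ltrN10.
have kappa1 : kappa <= 1 by rewrite gerBl expR_ge0.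
(* With D = s, the clock term of the upper-tail exponent is at most A s. [K] exceeds [A] by 2 so
   that s + 1 - K s + A s = 1 - s. *)
pose A : R := 2 * m%:R * expR 1 * m%:R.
have A0 : 0 <= A by rewrite !mulr_ge0 ?expR_ge0.
pose K : R := 2 + A.
exists (kappa / m%:R), (K / m%:R); split.
- by rewrite divr_gt0 //; lra.
- by rewrite ltr_pM2r ?invr_gt0 /K; lra.
pose n0 := maxn i 2.
have n02 : (2 <= n0)%N by exact: leq_maxr.
have hin0 : (0 < i <= n0)%N by rewrite hi leq_maxl.
pose s (n : nat) : R := Num.sqrt (ln n%:R).
(* The cost of starting the harmonic sum at [n0]; once s >= 1, B/s <= B. *)
pose B : R := m%:R * ln n0%:R.
have B0 : 0 <= B by rewrite mulr_ge0 // ln_ge0 // ler1n; lia.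
have s_oo : s n @[n --> \oo] --> +oo by exact: cvgry_sqrt_ln.
have exp_s c : expR (c - s n) @[n --> \oo] --> (0 : R).
  under eq_fun do rewrite expRD.
  rewrite -(mulr0 (expR c)); apply: cvgM; first exact: cvg_cst.
  exact: (cvg_comp _ _ s_oo (@cvgr_expR R)).
(* The two subtracted exponentials bound the probabilities of falling below and above the window. *)
apply: (@squeeze_cvge _ _ _ _
    (fun n => (1 - expR (B - s n) - expR (1 - s n))%:E) _ (cst 1%E)).
- near=> n.
  have n0n : (n0 <= n)%N by near: n; exact: nbhs_infty_ge.
  have s1 : 1 <= s n by near: n; have /cvgryPge := s_oo; exact.
  have sD : (2 * m * n0)%:R <= s n by near: n; have /cvgryPge := s_oo; exact.
  have s0 : 0 < s n by lra.
  have n2 : (2 <= n)%N by exact: leq_trans n0n.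
  have hin : (i <= n)%N by exact: leq_trans (leq_maxl _ _) n0n.
  have s2 : s n ^+ 2 = ln n%:R.
    by rewrite sqr_sqrtr // ln_ge0 // ler1n; lia.
  apply/andP; split; last first.
    apply: probability_le1.
    exact: (measurable_degree hG i
      [set u | kappa / m%:R <= u%:R / (m%:R * s n) <= K / m%:R] n2).
  have set_eq : [set w | kappa / m%:R <= (degree (G n w) i)%:R / (m%:R * s n) <= K / m%:R]
    = [set w | kappa * s n <= (degree (G n w) i)%:R <= K * s n].
    apply/funext => w; rewrite /mkset invfM [_^-1 * _]mulrC mulrA.
    by rewrite !ler_pM2r ?invr_gt0 ?ler_pdivlMr ?ler_pdivrMr //; lra.
  rewrite set_eq.
  have ks : (Num.truncn (kappa * s n))%:R <= kappa * s n.
    by rewrite truncn_le ltW // mulr_gt0.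
  have Ks : K * s n < (Num.truncn (K * s n)).+1%:R by exact: truncnS_gt.
  (* D is frozen at its value for the final [n], and the recursion runs from [n0] up to that [n]. *)
  have lower := degree_tail_lower hG m0 n02 hin0 (mulr_gt0 kappa0 s0) n0n
    (leq0n m) ks.
  have upper := degree_tail_upper hG m0 n02 hin0 s0 sD n0n (leq0n m)
    (Num.truncn (K * s n)).+1.
  have Hlo : ln n%:R - ln n0%:R <= harmonic_sum n0 n :> R.
    by apply: ln_le_harmonic_sum => //; exact: ltnW.
  have Hhi : harmonic_sum n0 n <= ln n%:R :> R by exact: harmonic_sum_le_ln.
  rewrite -s2 in Hlo Hhi.
  (* [v1] is the truncation of kappa s plus one: it is at least kappa s, while the complementary
     event d_i < v1 stays at a level within D. *)
  apply: le_trans (degree_window_prob hG n2 hin (v1 := (Num.truncn (kappa * s n)).+1)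
    (v2 := Num.truncn (K * s n)) _ _).
  + rewrite lee_fin.
    have {}lower : 1 - @degree_tail R d T P m G target i n 0 (Num.truncn (kappa * s n)).+1
        <= expR (B - s n).
      apply: le_trans lower _; rewrite ler_expR mul0r addr0 -/kappa.
      have -> : kappa / (kappa * s n) * (m%:R * harmonic_sum n0 n) =
          m%:R * harmonic_sum n0 n / s n by field; rewrite !gt_eqF.
      have : 2 * s n - B <= m%:R * harmonic_sum n0 n / s n.
        rewrite ler_pdivlMr //.
        apply: le_trans (ler_wpM2l (ler0n R m) Hlo).
        rewrite mulrBr -/B; nra.
      by nra.
    have {}upper : @degree_tail R d T P m G target i n 0 (Num.truncn (K * s n)).+1
        <= expR (1 - s n).
      apply: le_trans (upper) _; rewrite ler_expR mul0r addr0.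
      have -> : 2 * m%:R * expR 1 / s n * (m%:R * harmonic_sum n0 n) =
          A * harmonic_sum n0 n / s n by rewrite /A; field; rewrite gt_eqF.
      have : A * harmonic_sum n0 n / s n <= A * s n.
        by rewrite ler_pdivrMr // -[leRHS]mulrA -expr2 ler_wpM2l.
      by move: Ks; rewrite /K; lra.
    by lra.
  + by rewrite ltW // truncnS_gt.
  + by rewrite truncn_le mulr_ge0 ?(ltW s0) // addr_ge0.
- apply: cvg_EFin.
  + by near=> n.
  + rewrite -[X in _ --> X]subr0 -[X in _ --> X - _]subr0.
    apply: cvgB => //; apply: cvgB => //; exact: cvg_cst.
- exact: cvg_cst.
Unshelve. all: by end_near. Qed.
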